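(* Let $n\in\mathbb{N}$ and let $\mathbf{s}=(s_0,\ldots,s_n)\subset[0,\infty)$ be positive on $(0,1]$. Set $K=\mathrm{ind}_1(\mathbf{s})$ and $N=2K-1$. Then (i) $s_k\in\big(t_1((s_{k+1},\ldots,s_n)),\infty\big)$ for $k\in\mathbb{N}\cap[n-N,n-1]$; (ii) $s_k=t_1((s_{k+1},\ldots,s_{k+N+1}))$ for $k\in\mathbb{N}\cap[0,n-N-1]$.
   Context: For $a<b$ and a finite sequence $\mathbf{u}=(u_0,\ldots,u_m)$, $\mathbf{u}$ is positive on $[a,b]$ if the functional $\sigma(x^k)=u_k$ is $\ge0$ on every real polynomial of degree $\le m$ nonnegative on $[a,b]$; positive on $(0,1]$ means positive on some $[a,b]$ with $0<a<b\le1$. $\mathcal{M}_{a,b}(\mathbf{u})$ is the set of positive Borel measures on $[a,b]$ with $k$-th moments $u_k$; $\mathcal{M}_1(\mathbf{u})$ is the set of positive Borel measures on $(0,1]$ supported in some $[a,b]\subset(0,1]$, $a>0$, with these moments. For finitely supported $\mu$, $\mathrm{ind}_1(\mu)=\#(\mathrm{supp}\,\mu\cap(0,1))+\frac12\chi_{\mathrm{supp}\,\mu}(1)$, else $\infty$; $\mathrm{ind}_1(\mathbf{u})=\min\{\mathrm{ind}_1(\mu):\mu\in\mathcal{M}_1(\mathbf{u})\}$ (a half-integer or integer). $t_{a,b}(\mathbf{u})=\inf\{\int\frac1t\,d\mu:\mu\in\mathcal{M}_{a,b}(\mathbf{u})\}$ ($\inf\varnothing=\infty$) and $t_1(\mathbf{u})=\inf_{0<a<b\le1}t_{a,b}(\mathbf{u})$.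 *)

(* Defs.v *)
From HB Require Import structures.
From mathcomp Require Import all_boot all_order all_algebra.
From mathcomp Require Import all_classical all_reals all_analysis.
Set Implicit Arguments. Unset Strict Implicit. Unset Printing Implicit Defensive.
Import Order.TTheory GRing.Theory Num.Theory.
Import numFieldNormedType.Exports.
Local Open Scope classical_set_scope.
Local Open Scope ring_scope.

Section Defs.
Variable R : realType.
Local Notation mR := (measurableTypeR R).

(* A finite sequence u = (u_0,...,u_m) is a list of length m+1. *)

(* u is positive on [a,b]: the Riesz functional sigma(x^k) = u_k is >= 0 on
   every real polynomial of degree <= m that is nonnegative on [a,b]. *)
Definition positive_on (a b : R) (u : seq R) : Prop :=
  forall p : {poly R}, (size p <= size u)%N ->
    (forall x : R, a <= x <= b -> 0 <= p.[x]) ->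
    0 <= \sum_(k < size u) p`_k * u`_k.

Definition positive_on01 (u : seq R) : Prop :=
  exists a b : R, [/\ 0 < a, a < b, b <= 1 & positive_on a b u].

(* M_{a,b}(u): positive Borel measures on [a,b] (i.e. Borel measures on R
   vanishing outside [a,b]) whose k-th moments are u_k. *)
Definition Mab (a b : R) (u : seq R) (mu : {measure set mR -> \bar R}) : Prop :=
  mu (~` `[a, b]%classic) = 0%E /\
  forall k : nat, (k < size u)%N ->
    (\int[mu]_(x in `[a, b]%classic) (x ^+ k)%:E = (u`_k)%:E)%E.

Definition M1 (u : seq R) (mu : {measure set mR -> \bar R}) : Prop :=
  exists a b : R, [/\ 0 < a, a < b, b <= 1 & Mab a b u mu].

Definition fin_supp (mu : {measure set mR -> \bar R}) (S : seq R) : Prop :=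
  [/\ uniq S,
      (forall x : R, x \in S <-> (0 < mu [set x])%E) &
      mu (~` [set x | x \in S]) = 0%E].

(* Twice ind_1 of a finitely supported measure with support S:
   2 * #(S cap (0,1)) + chi_S(1). *)
Definition ind1x2_supp (S : seq R) : nat :=
  let open01 := [seq x <- S | (0 < x) && (x < 1)] in
  let has1 : bool := (1 : R) \in S in
  (2 * size open01 + has1)%N.

Definition ind1x2_set (u : seq R) : set nat :=
  [set d | exists (mu : {measure set mR -> \bar R}) (S : seq R),
     [/\ M1 u mu, fin_supp mu S & d = ind1x2_supp S]].

(* 2 * ind_1(u) = the minimum of the above set (ind_1 is a half-integer).
   If the set were empty (ind_1(u) = oo) we default to 0; under the
   hypotheses of the theorem the set is nonempty. *)
Definition ind1x2 (u : seq R) : nat :=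
  match pselect (exists d, `[< ind1x2_set u d >]) with
  | left h => ex_minn h
  | right _ => 0%N
  end.

(* t_{a,b}(u) = inf { int 1/t dmu : mu in M_{a,b}(u) }, inf of empty = +oo *)
Definition t_ab (a b : R) (u : seq R) : \bar R :=
  ereal_inf [set (\int[mu]_(x in `[a, b]%classic) (x^-1)%:E)%E
            | mu in [set mu | Mab a b u mu]].

Definition t_1 (u : seq R) : \bar R :=
  ereal_inf [set t_ab ab.1 ab.2 u
            | ab in [set ab : R * R | [/\ 0 < ab.1, ab.1 < ab.2 & ab.2 <= 1]]].

Definition subseqR (s : nat -> R) (i l : nat) : seq R := [seq s j | j <- iota i l].

End Defs.

(* Main.v *)
(** By Farkas' lemma applied to the moment curve, a sequence that is positive on
[[a, b]] is the moment sequence of a measure with finitely many atoms in [[a, b]].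
Let [S] be the atoms of a representing measure of index [K] of [s], and [omega]
the monic polynomial with a double root at each point of [S] in ]0, 1[ and a
simple root at 1 if 1 is in [S]. It has degree [2K], and it divides every
polynomial that vanishes on [S] and is nonnegative on [[a, 1]] for some [a] below [S].

For (i), [s_k, ..., s_n] has at most [2K] terms, so its functional is positive
on the nonzero polynomials of degree at most [n - k] that are nonnegative on
[[a, 1]]. By compactness it remains nonnegative there when [s_k] is slightly
decreased; if [nu] represents the new sequence, then [x nu] has the moments
[s_(k+1), ..., s_n] and its integral of [1/x] is less than [s_k].

For (ii), [q(t) = (1 - omega(t) / omega(0)) / t] is a polynomial of degree less
than [2K] that lies below [1/t] on ]0, 1] and agrees with it on [S]. Hence every
measure with the moments [s_(k+1), ..., s_(k+2K)] has an integral of [1/t] at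
least that of [q], which these moments determine: it is [s_k]. *)

Require Import Defs.
From HB Require Import structures.
From mathcomp Require Import all_boot all_order all_algebra.
From mathcomp Require Import all_classical all_reals all_analysis.
From mathcomp Require Import measurable_realfun ring lra.

Set Implicit Arguments.
Unset Strict Implicit.
Unset Printing Implicit Defensive.

Import Order.TTheory GRing.Theory Num.Theory.
Import numFieldNormedType.Exports.
Local Open Scope classical_set_scope.
Local Open Scope ring_scope.

Lemma ler_coord_norm {K : realDomainType} {m n : nat} (A : 'M[K]_(m, n)) i j :
  `|A i j| <= `|A|.
Proof.
rewrite [leRHS]/Num.norm /= mx_normrE; apply/bigmax_geP.
by right; exists (i, j).
Qed.

Lemma continuous_mx {S T : topologicalType} {m n : nat} (f : S -> 'M[T]_(m, n)) :
  (forall i j, continuous (fun x => f x i j)) -> continuous f.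
Proof.
move=> cf x A [P fxP PA].
have near_fxP : \forall y \near x, forall i j, P i j (f y i j).
  by do 2![apply: filter_forall => ?]; exact: cf.
by apply: filterS near_fxP => y; exact: PA.
Qed.

Section dot_product.
Context {R : comNzRingType} {m : nat}.
Implicit Types u v : 'rV[R]_m.

Definition dot u v : R := \sum_k u 0 k * v 0 k.

Lemma dotC u v : dot u v = dot v u.
Proof. by apply: eq_bigr => k _; rewrite mulrC. Qed.

Lemma dot_is_scalar u : scalar (dot u).
Proof.
move=> a v w; rewrite mulr_sumr -big_split; apply: eq_bigr => k _.
by rewrite !mxE mulrDr mulrCA.
Qed.

HB.instance Definition _ u := GRing.isLinear.Build R _ _ _ (dot u) (dot_is_scalar u).

Lemma dotZl a u v : dot (a *: u) v = a * dot u v.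
Proof. by rewrite dotC linearZ /= dotC. Qed.

Lemma dotB u v : dot (u - v) (u - v) = dot u u - dot u v *+ 2 + dot v v.
Proof. by rewrite linearB /= !(dotC (u - v)) !linearB /= (dotC v u); ring. Qed.

End dot_product.

Lemma dot_ge0 {R : realDomainType} {m : nat} (u : 'rV[R]_m) : 0 <= dot u u.
Proof. by apply: sumr_ge0 => k _; rewrite -expr2 sqr_ge0. Qed.

Lemma dot_eq0 {R : realDomainType} {m : nat} (u : 'rV[R]_m) : (dot u u == 0) = (u == 0).
Proof.
apply/eqP/eqP => [/eqP|->]; last by rewrite linear0.
rewrite psumr_eq0 => [/allP uu0|k _]; last by rewrite -expr2 sqr_ge0.
apply/rowP => k; rewrite mxE; apply/eqP; rewrite -sqrf_eq0 expr2.
exact/uu0/mem_index_enum.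
Qed.

Lemma continuous_dot {R : numFieldType} {m : nat} {T : topologicalType}
    (f g : T -> 'rV[R]_m) :
  continuous f -> continuous g -> continuous (fun x => dot (f x) (g x)).
Proof.
have coord (h : T -> 'rV[R]_m) k : continuous h -> continuous (fun x => h x 0 k).
  move=> ch x; apply: (@continuous_comp _ _ _ h (fun u => u 0 k)); first exact: ch.
  exact: coord_continuous.
move=> cf cg; apply: (@continuous_big _ _ _ 0 xpredT); first exact: add_continuous.
by move=> k _ x; apply: continuousM; exact: coord.
Qed.

Lemma continuous_dotr {R : numFieldType} {m : nat} (u : 'rV[R]_m) : continuous (dot u).
Proof.
by apply: (continuous_dot (f := cst u) (g := id)) => x; [exact: cst_continuous | exact: cvg_id].
Qed.

Definition dual_cone {R : numDomainType} {m : nat} (A : set 'rV[R]_m) : set 'rV[R]_m :=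
  [set y | forall p, A p -> 0 <= dot p y].

Lemma dual_coneZ {R : numDomainType} {m : nat} (A : set 'rV[R]_m) t y :
  0 <= t -> dual_cone A y -> dual_cone A (t *: y).
Proof. by move=> t0 Ay p /Ay; rewrite linearZ; exact: mulr_ge0. Qed.

Section dual_cone_topology.
Context {R : realType} {m : nat}.
Implicit Types (A : set 'rV[R]_m) (v y : 'rV[R]_m).

Lemma dual_cone_closed A : closed (dual_cone A).
Proof.
rewrite (_ : dual_cone A = \bigcap_(p in A) (dot p @^-1` [set r | 0 <= r])) //.
apply: closed_bigI => p _; apply: (continuous_closedP _).1; last exact: closed_ge.
exact: continuous_dotr.
Qed.

Lemma dual_cone_coercive A v :
  (forall y, dual_cone A y -> y != 0 -> 0 < dot v y) ->
  exists2 e, 0 < e & forall y, dual_cone A y -> e * `|y| <= dot v y.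
Proof.
move=> v_gt0; pose D := dual_cone A `&` [set y | `|y| = 1].
have normalize y : dual_cone A y -> y != 0 -> D (`|y|^-1 *: y).
  move=> Ay y0; split; first by apply: dual_coneZ; rewrite ?invr_ge0.
  by rewrite /= normrZ normfV normr_id mulVf ?normr_eq0.
have [D0|/set0P/negP/negPn/eqP D0] := pselect (D !=set0); last first.
  exists 1 => // y Ay; have [->|y0] := eqVneq y 0; first by rewrite normr0 mulr0 linear0.
  by have := normalize y Ay y0; rewrite D0.
have cD : compact D.
  apply: bounded_closed_compact.
    by exists 1; split=> // M M1 y [_ /= ->]; exact: ltW.
  apply: closedI; first exact: dual_cone_closed.
  rewrite (_ : mkset _ = Num.norm @^-1` [set r | r = 1]) //.
  by apply: (continuous_closedP _).1; [exact: norm_continuous | exact: closed_eq].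
have [y /set_mem [Ay y1] ymin] :=
  EVT_min_rV D0 cD (continuous_subspaceT (@continuous_dotr _ _ v)).
exists (dot v y); first by apply: v_gt0; rewrite // -normr_eq0 y1 oner_eq0.
move=> z Az; have [->|z0] := eqVneq z 0; first by rewrite normr0 mulr0 linear0.
have := ymin _ (mem_set (normalize z Az z0)).
by rewrite linearZ /= ler_pdivlMl ?normr_gt0 // mulrC.
Qed.

End dual_cone_topology.

Definition weighted_sums {R : pzRingType} {V : lmodType R} (N : nat) (W : set R) (A : set V)
    : set V :=
  [set v | exists (w : 'I_N -> R) (p : 'I_N -> V),
    [/\ forall i, W (w i), forall i, A (p i) & v = \sum_i w i *: p i]].

Lemma weighted_sumsS {R : pzRingType} {V : lmodType R} (N : nat) (W : set R) (A : set V) :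
  weighted_sums N.+1 W A =
  [set x.1 *: x.2.1 + x.2.2 | x in W `*` (A `*` weighted_sums N W A)].
Proof.
apply/seteqP; split=> [_ [w [p [Ww Ap ->]]]|_ [[t [q v]] [/= Wt [Aq [w [p [Ww Ap ->]]]]] <-]].
  exists (w ord0, (p ord0, \sum_i w (lift ord0 i) *: p (lift ord0 i))).
    do 2![split=> //=]; exists (w \o lift ord0), (p \o lift ord0).
    by split=> // i /=.
  by rewrite big_ord_recl.
exists (fun i => oapp w t (unlift ord0 i)), (fun i => oapp p q (unlift ord0 i)).
split; [by move=> i; case: unlift | by move=> i; case: unlift |].
by rewrite big_ord_recl unlift_none; congr (_ + _); apply: eq_bigr => i _; rewrite liftK.
Qed.

Lemma weighted_sums_compact {R : numFieldType} {V : normedModType R} (N : nat) (W : set R)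
    (A : set V) :
  compact W -> compact A -> compact (weighted_sums N W A).
Proof.
move=> cW cA; elim: N => [|N IH].
  rewrite (_ : weighted_sums 0 W A = [set 0]); first exact: compact_set1.
  apply/seteqP; split=> [_ [w [p [_ _ ->]]]|_ ->]; first by rewrite big_ord0.
  by exists (fun=> 0), (fun=> 0); split=> [[]//|[]//|]; rewrite big_ord0.
rewrite weighted_sumsS; apply: continuous_compact; last first.
  by apply: compact_setX => //; exact: compact_setX.
apply: continuous_subspaceT => x.
apply: cvgD; last by apply: (@cvg_comp _ _ _ snd snd); exact: cvg_snd.
apply: cvgZ; first exact: cvg_fst.
by apply: (@cvg_comp _ _ _ snd fst); [exact: cvg_snd | exact: cvg_fst].
Qed.

Lemma exists_linear_dependence_gt0 {R : realFieldType} {m : nat} (p : 'I_m.+1 -> 'rV[R]_m) :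
  exists (d : 'I_m.+1 -> R), (exists i, 0 < d i) /\ \sum_i d i *: p i = 0.
Proof.
pose P := \matrix_i p i.
have : kermx P != 0 by rewrite kermx_eq0 /row_free neq_ltn ltnS rank_leq_col.
case/rowV0Pn => v /sub_kermxP; rewrite mulmx_sum_row => vP /rV0Pn[i vi0].
have {}vP : \sum_i v 0 i *: p i = 0.
  by rewrite -[RHS]vP; apply: eq_bigr => j _; rewrite rowK.
have [vi|vi|vi] := ltgtP (v 0 i) 0; last by rewrite vi eqxx in vi0.
- exists (fun j => - v 0 j); split; first by exists i; rewrite oppr_gt0.
  by under eq_bigr do rewrite scaleNr; rewrite sumrN vP oppr0.
- by exists (v 0); split=> //; exists i.
Qed.

Section conic_hull.
Context {R : realFieldType} {m : nat} (A : set 'rV[R]_m).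
Implicit Types p v : 'rV[R]_m.

(* By Caratheodory's theorem [m] generators are enough in dimension [m]. *)
Definition conic_hull : set 'rV[R]_m := weighted_sums m [set t | 0 <= t] A.

Lemma conic_hull_caratheodory : weighted_sums m.+1 [set t | 0 <= t] A `<=` conic_hull.
Proof.
move=> _ [w [p [/= w0 Ap ->]]].
have [d [[i1 di1] dp]] := exists_linear_dependence_gt0 p.
pose ratio i := w i / d i.
have [i0 di0 ratio_min] := @arg_minP _ _ _ i1 (fun i => 0 < d i) ratio di1.
have ratio0 : 0 <= ratio i0 by rewrite divr_ge0 // ltW.
pose v i := w i - ratio i0 * d i.
have vi0 : v i0 = 0 by rewrite /v /ratio divfK ?subrr // gt_eqF.
exists (v \o lift i0), (p \o lift i0); split=> //= [i|].
  rewrite subr_ge0; have [di|di] := ltP 0 (d (lift i0 i)).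
    by rewrite -ler_pdivlMr // ratio_min.
  by apply: le_trans (w0 _); rewrite mulr_ge0_le0.
transitivity (\sum_i v i *: p i); last by rewrite (bigD1_ord i0) //= vi0 scale0r add0r.
under [RHS]eq_bigr do rewrite scalerBl -scalerA.
by rewrite sumrB -scaler_sumr dp scaler0 subr0.
Qed.

Lemma conic_hullZ t v : 0 <= t -> conic_hull v -> conic_hull (t *: v).
Proof.
move=> t0 [w [p [w0 Ap ->]]]; exists (fun i => t * w i), p; split=> //= [i|].
  by rewrite mulr_ge0 //; exact: w0.
by rewrite scaler_sumr; apply: eq_bigr => i _; rewrite scalerA.
Qed.

Lemma conic_hullD t p v : 0 <= t -> A p -> conic_hull v -> conic_hull (t *: p + v).
Proof.
move=> t0 Ap Cv; apply: conic_hull_caratheodory; rewrite weighted_sumsS.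
by exists (t, (p, v)).
Qed.

End conic_hull.

Lemma closest_point_obtuse {R : realFieldType} {m : nat} (C : set 'rV[R]_m) (u q c : 'rV[R]_m) :
  (forall t, 0 <= t <= 1 -> C (q + t *: (c - q))) ->
  (forall z, C z -> dot (u - q) (u - q) <= dot (u - z) (u - z)) ->
  dot (u - q) (c - q) <= 0.
Proof.
move=> segC qmin; set r := u - q; set d := c - q; rewrite leNgt; apply/negP => rd0.
have dd0 := dot_ge0 d; pose t := dot r d / (dot r d + dot d d).
have tE : t * (dot r d + dot d d) = dot r d by rewrite divfK // gt_eqF // ltr_wpDr.
have t0 : 0 < t by rewrite divr_gt0 // ltr_wpDr.
have t1 : t <= 1 by rewrite ler_pdivrMr ?mul1r ?lerDl // ltr_wpDr.
have := qmin _ (segC t _); rewrite t1 ltW // => /(_ isT).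
rewrite opprD addrA -/r -/d (dotB r) dotZl !linearZ /= -addrA lerDl -mulrnAr -mulrN -mulrDr.
by rewrite pmulr_rge0 // => tdd; have := mulr_gt0 t0 rd0; lra.
Qed.

Section farkas.
Context {R : realType} {m : nat} (A : set 'rV[R]_m) (e : 'rV[R]_m).
Hypotheses (A0 : A !=set0) (cA : compact A) (eA : forall p, A p -> 0 < dot e p).

Lemma conic_hull_weights_bounded :
  exists2 c, 0 < c & forall (w : 'I_m -> R) (p : 'I_m -> 'rV[R]_m),
    (forall i, 0 <= w i) -> (forall i, A (p i)) ->
    forall i, c * w i <= dot e (\sum_j w j *: p j).
Proof.
have [p0 /set_mem Ap0 p0min] :=
  EVT_min_rV A0 cA (continuous_subspaceT (@continuous_dotr _ _ e)).
exists (dot e p0) => [|w p w0 Ap i]; first exact: eA.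
have wp j : 0 <= w j * dot e (p j) by rewrite mulr_ge0 // ltW // eA.
rewrite linear_sum (bigD1 i) //= linearZ /= ler_wpDr //.
  by apply: sumr_ge0 => j _; rewrite linearZ wp.
by rewrite mulrC ler_wpM2l // p0min // mem_set.
Qed.

Lemma conic_hull_closest u :
  exists2 q, conic_hull A q &
    forall z, conic_hull A z -> dot (u - q) (u - q) <= dot (u - z) (u - z).
Proof.
have [c c0 cw] := conic_hull_weights_bounded.
(* A combination with a weight above [B] is farther from [u] than 0 is. *)
pose B := (dot e e + dot u u *+ 4) / c.
have B0 : 0 <= B by rewrite divr_ge0 ?(ltW c0) // addr_ge0 ?mulrn_wge0 ?dot_ge0.
pose K := weighted_sums m `[0, B]%classic A.
have K0 : K 0.
  case: A0 => p Ap; exists (fun=> 0), (fun=> p); split=> // [i|].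
    by rewrite /= in_itv /= lexx.
  by rewrite big1 // => i _; rewrite scale0r.
have cK : compact K by apply: weighted_sums_compact => //; exact: segment_compact.
have cdist : {within K, continuous (fun z => dot (u - z) (u - z))}.
  have cB : continuous (fun z : 'rV[R]_m => u - z).
    by move=> z; apply: continuousB; [exact: cst_continuous | exact: cvg_id].
  exact: continuous_subspaceT (continuous_dot cB cB).
have [q /set_mem [w [p [wB Ap qE]]] qmin] := EVT_min_rV (ex_intro _ _ K0) cK cdist.
exists q; first by exists w, p; split=> // i; have := wB i; rewrite /= in_itv => /andP[].
move=> _ [v [r [v0 Ar ->]]]; set z := \sum_i _.
have [far|near] := leP (dot u u) (dot (u - z) (u - z)).
  by apply: le_trans far; have := qmin 0 (mem_set K0); rewrite subr0.
apply/qmin/mem_set; exists v, r; split=> // i; rewrite /= in_itv /=; apply/andP; split.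
  exact: v0.
rewrite ler_pdivlMr // mulrC (le_trans (cw _ _ v0 Ar i)) // -/z.
have := dot_ge0 (e - z); have := dot_ge0 (2 *: u - z); have := dot_ge0 e.
by move: near (dot_ge0 u); rewrite !dotB !dotZl !linearZ /=; lra.
Qed.

Lemma conic_hull_bipolar u :
  (forall y, dual_cone A y -> 0 <= dot u y) -> conic_hull A u.
Proof.
move=> uA; have [q Cq qmin] := conic_hull_closest u; set r := u - q.
have r_le0 p : A p -> dot r p <= 0.
  move=> Ap; have := @closest_point_obtuse _ _ (conic_hull A) u q (p + q).
  rewrite addrK; apply=> // t /andP[t0 _].
  by rewrite addrC; exact: conic_hullD.
have rq_ge0 : 0 <= dot r q.
  have := @closest_point_obtuse _ _ (conic_hull A) u q 0.
  rewrite sub0r linearN /= oppr_le0; apply=> // t /andP[_ t1].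
  rewrite scalerN -[X in X - _]scale1r -scalerBl.
  by apply: conic_hullZ => //; rewrite subr_ge0.
have ru_le0 : dot r u <= 0.
  have := uA (- r); rewrite linearN oppr_ge0 /= dotC; apply=> p Ap.
  by rewrite linearN oppr_ge0 /= dotC r_le0.
suff /eqP : r == 0 by move/subr0_eq => ->.
by rewrite -dot_eq0 eq_le dot_ge0 andbT {2}/r linearB /= subr_le0 (le_trans ru_le0).
Qed.

End farkas.

Lemma dvdp_prod_XsubC_mup {F : fieldType} (s : seq F) (p : {poly F}) :
  p != 0 -> (forall x, count_mem x s <= mup x p)%N -> \prod_(x <- s) ('X - x%:P) %| p.
Proof.
elim: s p => [|x s IH] p p0 s_mup; first by rewrite big_nil dvd1p.
have /factor_theorem[q pE] : root p x.
  by apply/contraT => /mupNroot px; have := s_mup x; rewrite px /= eqxx.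
have q0 : q != 0 by apply: contraNneq p0; rewrite pE => ->; rewrite mul0r.
rewrite big_cons mulrC pE dvdp_mul // IH // => y.
have := s_mup y; rewrite pE mupM ?polyXsubC_eq0 // (@mup_XsubCX _ 1) /=.
by rewrite addnC leq_add2r.
Qed.

Lemma mup_interior_min {R : realType} (p : {poly R}) (a b x : R) :
  p != 0 -> a < x < b -> (forall t, a < t < b -> 0 <= p.[t]) -> root p x ->
  (1 < mup x p)%N.
Proof.
move=> p0 xab p_ge0 px; rewrite mup_geq //.
have /factor_theorem[q pE] := px.
have p'x : p^`().[x] = 0.
  have ab : a <= b by case/andP: xab => ax xb; rewrite ltW // (lt_trans ax).
  rewrite derivE derive1E; apply: derive_val; apply: (derive1_at_min ab).
  - by move=> t _; exact: derivable_horner.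
  - by rewrite in_itv.
  - by move=> t; rewrite in_itv /= (rootP px) => /p_ge0.
have /factor_theorem[r qE] : root q x.
  by move/eqP: p'x; rewrite pE derivM derivXsubC !hornerE subrr mulr0 add0r.
by rewrite pE qE -mulrA -expr2 dvdp_mull.
Qed.

Definition nonneg_on {R : numDomainType} (a b : R) (p : {poly R}) : Prop :=
  forall x, a <= x <= b -> 0 <= p.[x].

Section contact_poly.
Context {R : realType}.
Implicit Types (S : seq R) (p : {poly R}) (a t x : R).

(* The points of ]0, 1[ are doubled because a polynomial that is nonnegative
   around an interior root has a multiple root there. *)
Definition contact_nodes S : seq R :=
  let S' := [seq x <- S | (0 < x) && (x < 1)] in S' ++ S' ++ nseq ((1 : R) \in S) 1.

Definition contact_poly S : {poly R} := \prod_(x <- contact_nodes S) ('X - x%:P).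

Lemma size_contact_poly S : size (contact_poly S) = (ind1x2_supp S).+1.
Proof. by rewrite size_prod_XsubC !size_cat size_nseq addnA addnn -mul2n. Qed.

Lemma mem_contact_nodes S x : 0 < x <= 1 -> (x \in contact_nodes S) = (x \in S).
Proof.
move=> /andP[x0 x1]; rewrite !mem_cat orbA orbb mem_filter mem_nseq x0 /=.
rewrite lt_neqAle x1 andbT; case: eqP => [->|_] /=; last by rewrite andbF orbF.
by rewrite lt0b andbT.
Qed.

Lemma count_contact_nodes S x : uniq S ->
  count_mem x (contact_nodes S) =
  (((0 < x < 1)%R && (x \in S)).*2 + (x == 1%R :> R) * (1%R \in S))%N.
Proof.
move=> uS; rewrite !count_cat count_nseq !count_uniq_mem ?filter_uniq // mem_filter.
by rewrite addnA addnn eq_sym.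
Qed.

Lemma contact_poly0_neq0 S : (contact_poly S).[0] != 0.
Proof.
rewrite -[_ == 0]/(root _ 0) root_prod_XsubC !mem_cat mem_filter ltxx /= mem_nseq.
by rewrite (eq_sym 0) oner_eq0 andbF.
Qed.

Lemma contact_poly_ratio_ge0 S t : t <= 1 -> 0 <= (contact_poly S).[t] / (contact_poly S).[0].
Proof.
move=> t1; rewrite /contact_poly !horner_prod !big_cat /= mulrA mulrA.
rewrite -!expr2 invfM mulrACA -expr_div_n mulr_ge0 ?sqr_ge0 //.
rewrite !big_nseq; case: (1 \in S); rewrite /= ?divr1 ?ler01 // !mulr1 !hornerE.
by rewrite invrN1 mulrN1 opprB subr_ge0.
Qed.

Lemma contact_poly_dvdp S p a :
  0 <= a -> uniq S -> (forall x, x \in S -> a < x <= 1) ->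
  nonneg_on a 1 p -> (forall x, x \in S -> root p x) ->
  contact_poly S %| p.
Proof.
move=> a0 uS aS p_ge0 pS; have [->|p0] := eqVneq p 0; first exact: dvdp0.
apply: dvdp_prod_XsubC_mup => // x; rewrite count_contact_nodes //.
have [xS|xS] := boolP (x \in S); last first.
  by rewrite andbF; case: eqP => //= <-; rewrite (negbTE xS).
have /andP[ax x1] := aS x xS; have x0 : 0 < x by exact: le_lt_trans ax.
rewrite x0 /= andbT; case: (ltgtP x 1) x1 => // [x1|xE] _.
  apply: (@mup_interior_min _ _ a 1) => //; [by rewrite ax | | exact: pS].
  by move=> t /andP[at_ t1]; rewrite p_ge0 // !ltW.
by rewrite -xE xS -XsubC_dvd // dvdp_XsubCl pS.
Qed.

Lemma inverse_minorant S : (forall x, x \in S -> 0 < x <= 1) ->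
  exists q : {poly R}, [/\ (size q <= ind1x2_supp S)%N,
    forall t, 0 < t <= 1 -> q.[t] <= t^-1 & forall x, x \in S -> q.[x] = x^-1].
Proof.
move=> S01; pose r := (contact_poly S).[0]^-1 *: contact_poly S.
have /factor_theorem[q] : root (1 - r) 0.
  by rewrite /root !hornerE mulVf ?subrr // contact_poly0_neq0.
rewrite subr0 => qE; have qx t : t != 0 -> q.[t] = t^-1 - r.[t] / t.
  move=> t0; apply: (mulIf t0); rewrite -hornerMX -qE mulrBl divfK // mulVf //.
  by rewrite !hornerE.
exists q; split=> [|t /andP[t0 t1]|x xS].
- have [->|q0] := eqVneq q 0; first by rewrite size_poly0.
  rewrite -ltnS -size_mulX // -qE (leq_trans (size_polyD _ _)) // geq_max size_poly1.
  by rewrite size_polyN (leq_trans (size_scale_leq _ _)) ?size_contact_poly.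
- rewrite qx ?gt_eqF // gerBl divr_ge0 ?(ltW t0) // hornerZ mulrC.
  exact: contact_poly_ratio_ge0.
- have x01 := S01 x xS; have /andP[x0 _] := x01.
  have /rootP rx : root (contact_poly S) x by rewrite root_prod_XsubC mem_contact_nodes.
  by rewrite qx ?gt_eqF // hornerZ rx mulr0 mul0r subr0.
Qed.

End contact_poly.

Section atomic_representation.
Context {R : realType}.
Implicit Types (a b c x : R) (u S : seq R) (w : R -> R) (p : {poly R}).

Definition riesz u p : R := \sum_(k < size u) p`_k * u`_k.

Lemma riesz_cons c u p :
  riesz (c :: u) p = p`_0 * c + \sum_(k < size u) p`_k.+1 * u`_k.
Proof. by rewrite /riesz big_ord_recl. Qed.

Definition atomic_rep a b S w u : Prop :=
  [/\ uniq S, forall x, x \in S -> a <= x <= b, forall x, x \in S -> 0 < w x &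
      forall k, (k < size u)%N -> u`_k = \sum_(x <- S) w x * x ^+ k].

Lemma riesz_atomic a b S w u p : atomic_rep a b S w u -> (size p <= size u)%N ->
  riesz u p = \sum_(x <- S) w x * p.[x].
Proof.
move=> [_ _ _ uE] pu; rewrite /riesz; under eq_bigr do rewrite uE // mulr_sumr.
rewrite exchange_big; apply: eq_bigr => x _ /=; rewrite (horner_coef_wide x pu) mulr_sumr.
by apply: eq_bigr => k _; rewrite mulrCA.
Qed.

Lemma atomic_rep_atom_gt0 a b S w u x : 0 < a -> atomic_rep a b S w u -> x \in S -> 0 < x.
Proof. by move=> a0 [_ Sab _ _] /Sab /andP[ax _]; exact: lt_le_trans ax. Qed.

Lemma atomic_rep_behead a b S w c u : 0 < a ->
  atomic_rep a b S w (c :: u) -> atomic_rep a b S (fun x => w x * x) u.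
Proof.
move=> a0 Scu; have [uS Sab w0 uE] := Scu; split=> // [x xS|k ku].
  by rewrite mulr_gt0 ?w0 // (atomic_rep_atom_gt0 a0 Scu).
rewrite -[LHS]/((c :: u)`_k.+1) uE //.
by apply: eq_bigr => x _; rewrite exprS mulrA.
Qed.

Lemma atomic_rep_head a b S w c u : 0 < a ->
  atomic_rep a b S w (c :: u) -> \sum_(x <- S) (w x * x) * x^-1 = c.
Proof.
move=> a0 Scu; have [_ _ _ uE] := Scu; rewrite [RHS](uE 0%N) // big_seq [RHS]big_seq.
apply: eq_bigr => x xS; rewrite mulfK ?mulr1 // gt_eqF //.
exact: atomic_rep_atom_gt0 a0 Scu xS.
Qed.

Lemma atomic_rep_gather (I : finType) (x c : I -> R) a b u :
  (forall i, a <= x i <= b) -> (forall i, 0 <= c i) ->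
  (forall k, (k < size u)%N -> u`_k = \sum_i c i * x i ^+ k) ->
  exists S w, atomic_rep a b S w u.
Proof.
move=> xab c0 uE; pose S := undup [seq x i | i <- enum I & 0 < c i].
have memS i : 0 < c i -> x i \in S.
  by move=> ci; rewrite mem_undup map_f // mem_filter ci mem_enum.
exists S, (fun y => \sum_(i | x i == y) c i); split.
- exact: undup_uniq.
- by move=> y; rewrite mem_undup => /mapP[i _ ->].
- move=> y; rewrite mem_undup => /mapP[i]; rewrite mem_filter => /andP[ci _] ->.
  by rewrite (bigD1 i) //= ltr_pwDl // sumr_ge0.
move=> k ku; under [RHS]eq_bigr do rewrite mulr_suml.
rewrite uE // (exchange_big_dep predT) //=; apply: eq_bigr => i _.
have [xS|xS] := boolP (x i \in S).
  under eq_bigl do rewrite eq_sym.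
  by rewrite -big_filter filter_pred1_uniq ?undup_uniq // big_seq1.
have -> : c i = 0 by apply/eqP; rewrite eq_le c0 andbT leNgt; apply: contra xS; exact: memS.
by rewrite mul0r big1 // => y _; rewrite mul0r.
Qed.

Definition moment_row m x : 'rV[R]_m := \row_k x ^+ k.

Lemma continuous_moment_row m : continuous (moment_row m).
Proof.
apply: continuous_mx => i k; rewrite (_ : (fun _ => _) = @GRing.exp R ^~ k).
  exact: exprn_continuous.
by apply/funext => x; rewrite mxE.
Qed.

Lemma dot_moment_row m (y : 'rV[R]_m) x : dot (moment_row m x) y = (rVpoly y).[x].
Proof.
rewrite (horner_coef_wide x (size_poly _ _)); apply: eq_bigr => k _.
by rewrite mxE coef_rVpoly_ord mulrC.
Qed.

Lemma dot_row_seq u (y : 'rV[R]_(size u)) : dot (\row_k u`_k) y = riesz u (rVpoly y).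
Proof. by apply: eq_bigr => k _; rewrite mxE coef_rVpoly_ord mulrC. Qed.

Definition moment_curve {m} a b : set 'rV[R]_m := moment_row m @` `[a, b].

Lemma dual_cone_moment_curve m a b (y : 'rV[R]_m) :
  dual_cone (moment_curve a b) y <-> nonneg_on a b (rVpoly y).
Proof.
split=> [y_ge0 x xab|y_ge0 _ [x /= xab <-]].
  by rewrite -dot_moment_row; apply: y_ge0; exists x => //=; rewrite in_itv.
by rewrite dot_moment_row y_ge0 // -in_itv.
Qed.

Lemma positive_on_atomic_rep a b u : a <= b -> (0 < size u)%N -> positive_on a b u ->
  exists S w, atomic_rep a b S w u.
Proof.
move=> ab u0 upos; pose A : set 'rV[R]_(size u) := moment_curve a b.
have A0 : A !=set0 by exists (moment_row _ a), a => //=; rewrite in_itv /= lexx.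
have cA : compact A.
  apply: continuous_compact; last exact: segment_compact.
  exact/continuous_subspaceT/continuous_moment_row.
have eA q : A q -> 0 < dot (delta_mx 0 (Ordinal u0)) q.
  by move=> [x _ <-]; rewrite dotC dot_moment_row rVpoly_delta hornerXn ltr01.
have [|c [q [c0 Aq uE]]] := conic_hull_bipolar A0 cA eA (u := \row_k u`_k).
  move=> y /dual_cone_moment_curve y_ge0; rewrite dot_row_seq.
  by apply: upos => //; exact: size_poly.
have /choice[x xq] i : exists x, a <= x <= b /\ moment_row _ x = q i.
  by have [x xab <-] := Aq i; exists x; split; rewrite // -in_itv.
apply: (@atomic_rep_gather _ x c) => [i|//|k ku]; first by case: (xq i).
have := congr1 (fun v : 'rV_(size u) => v 0 (Ordinal ku)) uE.
rewrite mxE summxE /= => ->; apply: eq_bigr => i _.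
by rewrite mxE -(xq i).2 mxE.
Qed.

Lemma positive_on_decrease_head a b c u :
  (forall p, p != 0 -> (size p <= (size u).+1)%N -> nonneg_on a b p ->
    0 < riesz (c :: u) p) ->
  exists2 e, 0 < e & positive_on a b (c - e :: u).
Proof.
move=> cu_gt0; pose A : set 'rV[R]_(size (c :: u)) := moment_curve a b.
have [|e e0 eP] := @dual_cone_coercive _ _ A (\row_k (c :: u)`_k).
  move=> y /dual_cone_moment_curve y_ge0 y0; rewrite dot_row_seq.
  apply: cu_gt0 => //; last exact: size_poly.
  by apply: contraNneq y0 => py0; rewrite -(rVpolyK y) py0 linear0.
exists e => // p pu p_ge0; pose y : 'rV_(size (c :: u)) := poly_rV p.
have yE : rVpoly y = p by rewrite poly_rV_K.
have coercive : e * `|y| <= riesz (c :: u) p.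
  by rewrite -yE -dot_row_seq; apply/eP/dual_cone_moment_curve; rewrite yE.
have p0y : p`_0 <= `|y|.
  by rewrite -yE (coef_rVpoly_ord y ord0) (le_trans (ler_norm _)) // ler_coord_norm.
rewrite -[leRHS]/(riesz _ _) riesz_cons mulrBr addrAC -riesz_cons subr_ge0.
by apply: le_trans coercive; rewrite mulrC ler_pM2l.
Qed.

Lemma riesz_atomic_gt0 a a' S w u p : 0 <= a' -> a' < a ->
  atomic_rep a 1 S w u -> (size u <= ind1x2_supp S)%N ->
  p != 0 -> (size p <= size u)%N -> nonneg_on a' 1 p -> 0 < riesz u p.
Proof.
move=> a'0 a'a Su uS_le p0 pu p_ge0; have [uS Sa1 w0 _] := Su.
have S_a'1 x : x \in S -> a' < x <= 1.
  by move=> /Sa1 /andP[ax ->]; rewrite (lt_le_trans a'a ax).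
have wp_ge0 x : x \in S -> 0 <= w x * p.[x].
  move=> xS; rewrite mulr_ge0 ?(ltW (w0 x xS)) ?p_ge0 //.
  by case/andP: (S_a'1 x xS) => /ltW -> ->.
rewrite (riesz_atomic Su pu) lt_neqAle big_seq sumr_ge0 // andbT.
apply: contraL uS_le; rewrite eq_sym psumr_eq0 // => /allP wp0; rewrite -ltnNge.
have : contact_poly S %| p.
  apply: (contact_poly_dvdp a'0) => // x xS.
  by have := wp0 x xS; rewrite xS mulf_eq0 gt_eqF ?w0.
by move=> /(dvdp_leq p0); rewrite size_contact_poly => /leq_trans; apply.
Qed.

Lemma size_subseqR (s : nat -> R) i l : size (subseqR s i l) = l.
Proof. by rewrite size_map size_iota. Qed.

Lemma nth_subseqR (s : nat -> R) i l j : (j < l)%N -> (subseqR s i l)`_j = s (i + j)%N.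
Proof. by move=> jl; rewrite (nth_map 0%N) ?size_iota // nth_iota. Qed.

Lemma atomic_rep_subseqR a b S w (s : nat -> R) n k l : 0 < a -> (k + l <= n)%N ->
  atomic_rep a b S w (subseqR s 0 n) ->
  atomic_rep a b S (fun x => w x * x ^+ k) (subseqR s k l).
Proof.
move=> a0 kln Ss; have [uS Sab w0 sE] := Ss; rewrite size_subseqR in sE.
split=> // [x xS|j]; first by rewrite mulr_gt0 ?w0 // exprn_gt0 // (atomic_rep_atom_gt0 a0 Ss).
rewrite size_subseqR => jl; have kjn : (k + j < n)%N.
  by rewrite (leq_trans _ kln) // -addnS leq_add2l.
have := sE _ kjn; rewrite !nth_subseqR // add0n => ->.
by apply: eq_bigr => x _; rewrite exprD mulrA.
Qed.

End atomic_representation.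

Lemma ge0_integral_concentrated {d : measure_display} {T : measurableType d} {R : realType}
    (mu : {measure set T -> \bar R}) (S : seq T) (D : set T) (f : T -> \bar R) :
  (forall x : T, measurable [set x]) -> measurable D -> uniq S -> [set` S] `<=` D ->
  mu (~` [set` S]) = 0%E -> measurable_fun D f -> (forall x, D x -> 0 <= f x)%E ->
  (\int[mu]_(x in D) f x = \sum_(x <- S) f x * mu [set x])%E.
Proof.
move=> m1 mD uS SD muS mf f0.
have SE : [set` S] = \big[setU/set0]_(x <- S) [set x].
  rewrite -bigcup_seq; apply/seteqP; split=> [y /= yS|y [z /= zS ->]//].
  by exists y.
have mS : measurable [set` S] by rewrite SE; exact: bigsetU_measurable.
rewrite (ge0_negligible_integral _ mD mf _ muS) //; last exact: measurableC.
rewrite setDE setCK setIC setIidl // SE ge0_integral_bigsetU //=.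
- apply: eq_bigr => x _.
  transitivity (\int[mu]_(y in [set x]) cst (f x) y)%E.
    by apply: eq_integral => y; rewrite inE => ->.
  by rewrite integral_cst.
- by move=> x y _ _ [z [-> ->]].
- by rewrite -SE; exact: measurable_funS mf.
- by move=> y; rewrite -SE => /SD /f0.
Qed.

Lemma continuous_inv_itv {R : realType} (a b : R) : 0 < a ->
  {within `[a, b], continuous (fun x : R => x^-1)}.
Proof.
move=> a0; apply: continuous_in_subspaceT => x; rewrite inE /= in_itv => /andP[ax _].
by apply: inv_continuous; rewrite gt_eqF // (lt_le_trans a0).
Qed.

Section moment_functional.
Context {R : realType}.
Local Notation mR := (measurableTypeR R).
Variables (a b : R) (u : seq R) (mu : {measure set mR -> \bar R}).
Hypothesis mu_u : Mab a b u mu.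

Lemma Mab_mass : (0 < size u)%N -> mu `[a, b]%classic = (u`_0)%:E.
Proof.
move=> u0; rewrite -(mu_u.2 0%N) //; under eq_integral do rewrite expr0.
by rewrite integral_cst // mul1e.
Qed.

Lemma Mab_integrable (f : R -> R) : (0 < size u)%N -> {within `[a, b], continuous f} ->
  mu.-integrable `[a, b] (EFin \o f).
Proof.
move=> u0 cf; apply: measurable_bounded_integrable => //.
- by rewrite Mab_mass // ltry.
- exact: subspace_continuous_measurable_fun.
have /compact_bounded[M [Mreal fM]] := continuous_compact cf (@segment_compact _ a b).
by exists M; split=> // r Mr x xab; apply: fM Mr _ _; exists x.
Qed.

Lemma Mab_integral_horner (p : {poly R}) : (size p <= size u)%N ->
  (\int[mu]_(x in `[a, b]) (p.[x])%:E)%E = (riesz u p)%:E.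
Proof.
move=> pu; have [u0|u0] := posnP (size u).
  move: pu; rewrite u0 leqn0 size_poly_eq0 => /eqP ->.
  rewrite /riesz big1 => [|k _]; last by rewrite coef0 mul0r.
  by apply: integral0_eq => x _; rewrite horner0.
have intX k : mu.-integrable `[a, b] (fun x => (x ^+ k)%:E).
  by apply: (Mab_integrable u0); apply: continuous_subspaceT; exact: exprn_continuous.
transitivity (\int[mu]_(x in `[a, b]) \sum_(k < size u) (p`_k)%:E * (x ^+ k)%:E)%E.
  by apply: eq_integral => x _; rewrite (horner_coef_wide x pu) -sumEFin.
rewrite integral_sum // => [|k]; last exact: integrableZl.
by rewrite -sumEFin; apply: eq_bigr => k _; rewrite integralZl // mu_u.2.
Qed.

End moment_functional.

Section atomic_measure.
Context {R : realType}.
Local Notation mR := (measurableTypeR R).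
Implicit Types (a b : R) (S u : seq R) (w f : R -> R).

(* The absolute value only makes [atomic_measure] total in [w]. *)
Definition atomic_measure S w : {measure set mR -> \bar R} :=
  msum (fun i => mscale `|w S`_i|%:nng (@dirac _ mR S`_i R)) (size S).

Section positive_weights.
Variables (S : seq R) (w : R -> R).
Hypotheses (uS : uniq S) (w_gt0 : forall x, x \in S -> 0 < w x).

Lemma atomic_measureE (A : set R) :
  atomic_measure S w A = (\sum_(x <- S) w x * \1_A x)%:E.
Proof.
rewrite (big_nth 0) big_mkord -sumEFin; apply: eq_bigr => i _ /=.
by rewrite /mscale /= gtr0_norm ?w_gt0 ?mem_nth.
Qed.

Lemma atomic_measure_set1 x : x \in S -> atomic_measure S w [set x] = (w x)%:E.
Proof.
move=> xS; rewrite atomic_measureE (bigD1_seq x) //= indicE mem_set // mulr1.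
rewrite big1 ?addr0 // => y yx; rewrite indicE memNset ?mulr0 //= => yE.
by rewrite yE eqxx in yx.
Qed.

Lemma atomic_measure_eq0 A : (forall x, x \in S -> ~ A x) -> atomic_measure S w A = 0%E.
Proof.
move=> SA; rewrite atomic_measureE big_seq big1 // => x xS.
by rewrite indicE memNset ?mulr0 //; exact: SA.
Qed.

Lemma fin_supp_atomic_measure : fin_supp (atomic_measure S w) S.
Proof.
split=> // [x|]; last by apply: atomic_measure_eq0 => x xS; exact.
split=> [xS|]; first by rewrite atomic_measure_set1 // lte_fin w_gt0.
apply: contraTT => xS; rewrite atomic_measure_eq0 ?ltxx // => y yS /= yx.
by rewrite -yx yS in xS.
Qed.

End positive_weights.

Lemma integral_atoms (mu : {measure set mR -> \bar R}) a b S w f :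
  0 < a -> uniq S -> (forall x, x \in S -> a <= x <= b) ->
  mu (~` [set` S]) = 0%E -> (forall x, x \in S -> mu [set x] = (w x)%:E) ->
  {within `[a, b], continuous f} -> (forall x, 0 < x -> 0 <= f x) ->
  (\int[mu]_(x in `[a, b]) (f x)%:E)%E = (\sum_(x <- S) w x * f x)%:E.
Proof.
move=> a0 uS Sab muS muw cf f0.
rewrite (@ge0_integral_concentrated _ _ _ mu S) //; last first.
- by move=> x /=; rewrite in_itv => /andP[ax _]; rewrite lee_fin f0 // (lt_le_trans a0).
- by apply/measurable_EFinP; exact: subspace_continuous_measurable_fun.
rewrite -sumEFin big_seq [RHS]big_seq; apply: eq_bigr => x xS.
by rewrite muw // -EFinM mulrC.
Qed.

Lemma integral_atomic_measure a b S w u f : 0 < a -> atomic_rep a b S w u ->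
  {within `[a, b], continuous f} -> (forall x, 0 < x -> 0 <= f x) ->
  (\int[atomic_measure S w]_(x in `[a, b]) (f x)%:E)%E = (\sum_(x <- S) w x * f x)%:E.
Proof.
move=> a0 [uS Sab w0 _]; apply: integral_atoms => //.
  by apply: atomic_measure_eq0 => // x xS; exact.
exact: atomic_measure_set1.
Qed.

Lemma Mab_atomic_measure a b S w u : 0 < a -> atomic_rep a b S w u ->
  Mab a b u (atomic_measure S w).
Proof.
move=> a0 Su; have [_ Sab w0 uE] := Su; split=> [|k ku].
  by apply: atomic_measure_eq0 => // x /Sab xab; apply; rewrite /= in_itv.
rewrite (integral_atomic_measure a0 Su) ?uE // => [|x /ltW]; last exact: exprn_ge0.
exact/continuous_subspaceT/exprn_continuous.
Qed.

Lemma fin_supp_atomic_rep (mu : {measure set mR -> \bar R}) a b S u :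
  0 < a -> (0 < size u)%N -> Mab a b u mu -> fin_supp mu S ->
  exists w, atomic_rep a b S w u.
Proof.
move=> a0 u0 mu_u [uS Smu muS]; have [mu0 muE] := mu_u.
have Sab x : x \in S -> a <= x <= b.
  move=> /Smu mux; apply/negPn/negP => xab.
  have : (mu [set x] <= mu (~` `[a, b]))%E.
    apply: le_measure; rewrite ?inE //; first exact: measurableC.
    by move=> y /= ->; rewrite in_itv /=; apply/negP.
  by rewrite mu0 leNgt mux.
have mu_fin x : x \in S -> mu [set x] \is a fin_num.
  move=> xS; rewrite ge0_fin_numE // (@le_lt_trans _ _ (mu `[a, b]%classic)) //; last first.
    by rewrite (Mab_mass mu_u u0) ltry.
  by apply: le_measure; rewrite ?inE // => y /= ->; rewrite in_itv /= Sab.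
exists (fun x => fine (mu [set x])); split=> // [x xS|k ku].
  by rewrite fine_gt0 // -ge0_fin_numE // mu_fin // (Smu x).1.
apply: EFin_inj; rewrite -muE //; apply: integral_atoms => // [x /mu_fin /fineK //||x /ltW].
  exact/continuous_subspaceT/exprn_continuous.
exact: exprn_ge0.
Qed.

End atomic_measure.

Lemma ind1x2_attained {R : realType} (u : seq R) : (0 < size u)%N -> positive_on01 u ->
  exists a S w, [/\ 0 < a, a < 1, atomic_rep a 1 S w u & ind1x2 u = ind1x2_supp S].
Proof.
move=> u0 [a [b [a0 ab b1 upos]]].
have ind_u : exists d, ind1x2_set u d.
  have [S [w Su]] := positive_on_atomic_rep (ltW ab) u0 upos.
  exists (ind1x2_supp S), (atomic_measure S w), S; split=> //.
    by exists a, b; split=> //; exact: Mab_atomic_measure Su.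
  by have [uS _ w0 _] := Su; exact: fin_supp_atomic_measure.
rewrite /ind1x2; case: pselect => [h|[]]; last first.
  by have [d ud] := ind_u; exists d; exact/asboolP.
case: ex_minnP => d /asboolP[mu [S [[a' [b' [a'0 a'b' b'1 mu_u]]] muS ->]]] _.
have [w [uS Sab w0 uE]] := fin_supp_atomic_rep a'0 u0 mu_u muS.
exists a', S, w; split=> //; first exact: lt_le_trans b'1.
by split=> // x /Sab /andP[-> xb]; exact: le_trans b'1.
Qed.

Section t_1.
Context {R : realType}.
Implicit Types (a b c : R) (S u : seq R) (w : R -> R).

Lemma t_1_le_head a b S w c u : 0 < a -> a < b -> b <= 1 ->
  atomic_rep a b S w (c :: u) -> (t_1 u <= c%:E)%E.
Proof.
move=> a0 ab b1 Scu; have Su := atomic_rep_behead a0 Scu.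
pose nu := atomic_measure S (fun x => w x * x).
have nu_inv : (\int[nu]_(x in `[a, b]) (x^-1)%:E)%E = c%:E.
  rewrite (integral_atomic_measure a0 Su) ?(atomic_rep_head a0 Scu) //.
    exact: continuous_inv_itv.
  by move=> x x0; rewrite invr_ge0 ltW.
apply: (@le_trans _ _ (t_ab a b u)); apply: ereal_inf_lbound; first by exists (a, b).
by exists nu => //; exact: Mab_atomic_measure Su.
Qed.

Lemma riesz_le_t_1 u (q : {poly R}) :
  (size q <= size u)%N -> (forall x, 0 < x <= 1 -> q.[x] <= x^-1) ->
  ((riesz u q)%:E <= t_1 u)%E.
Proof.
move=> qu q_le; apply: le_ereal_inf_tmp => _ [[a b] [/= a0 ab b1] <-].
apply: le_ereal_inf_tmp => _ [mu mu_u <-]; rewrite -(Mab_integral_horner mu_u qu).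
have q_le_inv x : `[a, b]%classic x -> q.[x] <= x^-1.
  rewrite /= in_itv => /andP[ax xb]; apply: q_le.
  by rewrite (lt_le_trans a0 ax) (le_trans xb b1).
have [u0|u0] := posnP (size u).
  move: qu; rewrite u0 leqn0 size_poly_eq0 => /eqP ->.
  rewrite integral0_eq => [|x _]; last by rewrite horner0.
  by apply: integral_ge0 => x /=; rewrite in_itv => /andP[ax _];
    rewrite lee_fin invr_ge0 ltW // (lt_le_trans a0).
apply: le_integral => //.
- by apply: (Mab_integrable mu_u u0); apply: continuous_subspaceT; exact: continuous_horner.
- by apply: (Mab_integrable mu_u u0); exact: continuous_inv_itv.
- by move=> x; rewrite inE lee_fin; exact: q_le_inv.
Qed.

Lemma t_1_lt_head a S w c u : 0 < a -> a < 1 -> atomic_rep a 1 S w (c :: u) ->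
  (size u < ind1x2_supp S)%N -> (t_1 u < c%:E)%E.
Proof.
move=> a0 a1 Scu uS_lt.
have [a'0 a'a] : 0 < a / 2 /\ a / 2 < a by split; lra.
have [p|e e0] := @positive_on_decrease_head _ (a / 2) 1 c u.
  exact: riesz_atomic_gt0 (ltW a'0) a'a Scu uS_lt.
move=> /positive_on_atomic_rep[|//|T [v Tv]]; first by rewrite ltW // (lt_trans a'a).
apply: (le_lt_trans (t_1_le_head a'0 (lt_trans a'a a1) (lexx 1) Tv)).
by rewrite lte_fin ltrBlDr ltrDl.
Qed.

Lemma t_1_eq_head a S w c u : 0 < a -> a < 1 -> atomic_rep a 1 S w (c :: u) ->
  size u = ind1x2_supp S -> t_1 u = c%:E.
Proof.
move=> a0 a1 Scu uS; apply/eqP; rewrite eq_le (t_1_le_head a0 a1 (lexx 1) Scu) /=.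
have S01 x : x \in S -> 0 < x <= 1.
  by have [_ Sa1 _ _] := Scu; move=> /Sa1 /andP[ax ->]; rewrite (lt_le_trans a0 ax).
have [q [qS q_le q_inv]] := inverse_minorant S01; rewrite -uS in qS.
suff <- : riesz u q = c by exact: riesz_le_t_1.
rewrite (riesz_atomic (atomic_rep_behead a0 Scu) qS) -(atomic_rep_head a0 Scu).
by rewrite big_seq [RHS]big_seq; apply: eq_bigr => x /q_inv ->.
Qed.

End t_1.

(* K = ind_1(s) is encoded as ind1x2 = 2K; N = 2K - 1, so
   k in [n-N, n-1]  <->  n+1 <= k + 2K /\ k <= n-1,
   k in [0, n-N-1]  <->  k + 2K <= n,
   (s_{k+1},...,s_{k+N+1}) has length N+1 = 2K. *)
Theorem theorem8p6 (R : realType) (n : nat) (s : nat -> R) :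
  (forall i, (i <= n)%N -> 0 <= s i) ->
  positive_on01 [seq s i | i <- iota 0 n.+1] ->
  let K2 := ind1x2 [seq s i | i <- iota 0 n.+1] in
  (forall k : nat, (n.+1 <= k + K2)%N -> (k < n)%N ->
     (t_1 (subseqR s k.+1 (n - k)) < (s k)%:E)%E) /\
  (forall k : nat, (k + K2 <= n)%N ->
     (s k)%:E = t_1 (subseqR s k.+1 K2)).
Proof.
move=> _ /ind1x2_attained; rewrite size_map size_iota => -[//|a [S [w [a0 a1 Ss ->]]]] /=.
have shifted_rep k l : (k + l <= n)%N ->
    atomic_rep a 1 S (fun x => w x * x ^+ k) (s k :: subseqR s k.+1 l).
  by move=> kl; apply: (@atomic_rep_subseqR _ a 1 S w s n.+1 k l.+1); rewrite ?addnS.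
split=> k.
  move=> n_lt k_lt; apply: (t_1_lt_head a0 a1 (shifted_rep k (n - k)%N _)).
    by rewrite subnKC // ltnW.
  by rewrite size_subseqR ltn_subLR // ltnW.
by move=> kn; rewrite (t_1_eq_head a0 a1 (shifted_rep k _ kn)) // size_subseqR.
Qed.
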